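(* Let $\beta\in(0,1)$, let $\bar x\in\mathbb{R}^n$, and let $(\bar a,\bar u)\in P_{\bar x}\times\mathbb{R}^n$ be such that $\Phi(\bar x)=\xi_{\bar x}(\bar a,\bar u)$. Write $\bar w=w(\bar x)$ and assume that $\bar x$ is not a stationary point of the set optimization problem $\preceq^l\text{-}\min_{x\in\mathbb{R}^n}F(x)$. Then there exists $\widetilde t>0$ such that for all $t\in(0,\widetilde t]$ and all $j\in[\bar w]$, $$f^{\bar a_j}(\bar x+t\bar u)\preceq f^{\bar a_j}(\bar x)+\beta t\,\nabla f^{\bar a_j}(\bar x)^\top\bar u.$$ Additionally, for all $t\in(0,\widetilde t]$, $$F(\bar x+t\bar u)\preceq^l\{f^{\bar a_j}(\bar x)+\beta t\,\nabla f^{\bar a_j}(\bar x)^\top\bar u\}_{j\in[\bar w]}\prec^lF(\bar x).$$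
   Context: $K\subseteq\mathbb{R}^m$ is a closed, convex, pointed ($K\cap(-K)=\{0\}$), solid ($\operatorname{int}K\neq\emptyset$) cone. For $y,z\in\mathbb{R}^m$: $y\preceq z$ iff $z-y\in K$, and $y\prec z$ iff $z-y\in\operatorname{int}(K)$. For nonempty $A,B\subseteq\mathbb{R}^m$: $A\preceq^lB$ iff $B\subseteq A+K$, and $A\prec^lB$ iff $B\subseteq A+\operatorname{int}(K)$. Standing assumption: $F(x)=\{f^1(x),\ldots,f^p(x)\}$ for $x\in\mathbb{R}^n$, where $f^1,\ldots,f^p:\mathbb{R}^n\to\mathbb{R}^m$ are twice continuously differentiable and $K$-strongly convex with respect to a common $e\in\operatorname{int}(K)$: there are $\rho_1,\ldots,\rho_p>0$ such that for every $i\in[p]=\{1,\ldots,p\}$, $x_1,x_2\in\mathbb{R}^n$, $\lambda\in[0,1]$, $f^i(\lambda x_1+(1-\lambda)x_2)\preceq\lambda f^i(x_1)+(1-\lambda)f^i(x_2)-\tfrac12\rho_i\lambda(1-\lambda)\|x_1-x_2\|^2e$. For $f^i=(f^{i,1},\ldots,f^{i,m})^\top$ and $u\in\mathbb{R}^n$, $\nabla f^i(x)^\top u\in\mathbb{R}^m$ denotes the Jacobian of $f^i$ at $x$ applied to $u$, and $u^\top\nabla^2f^i(x)u$ denotes the vector $(u^\top\nabla^2f^{i,1}(x)u,\ldots,u^\top\nabla^2f^{i,m}(x)u)^\top\in\mathbb{R}^m$. Gerstewitz function: $\Psi_e(z)=\min\{t\in\mathbb{R}: te\in z+K\}$, $z\in\mathbb{R}^m$.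 $\operatorname{Min}(A,K)=\{z\in A:(z-K)\cap A=\{z\}\}$. $I(x)=\{i\in[p]:f^i(x)\in\operatorname{Min}(F(x),K)\}$; $w(x)=|\operatorname{Min}(F(x),K)|$; for $r\in\mathbb{R}^m$, $I_r(x)=\{i\in I(x):f^i(x)=r\}$. Fixing an enumeration $\{r_1^x,\ldots,r_{w(x)}^x\}$ of $\operatorname{Min}(F(x),K)$, the partition set at $x$ is $P_x=\prod_{j=1}^{w(x)}I_{r_j^x}(x)$; its elements are written $a=(a_1,\ldots,a_{w(x)})$. Stationary point: $\bar x$ is stationary if for every $a\in P_{\bar x}$ and every $u\in\mathbb{R}^n$ there exists $j\in[w(\bar x)]$ with $\nabla f^{a_j}(\bar x)^\top u\notin-\operatorname{int}(K)$. For $x\in\mathbb{R}^n$, $a\in P_x$, $u\in\mathbb{R}^n$: $\xi_x(a,u)=\max_{j\in[w(x)]}\Psi_e\big(\nabla f^{a_j}(x)^\top u+\tfrac12u^\top\nabla^2f^{a_j}(x)u\big)$, and $\Phi(x)=\min_{(a,u)\in P_x\times\mathbb{R}^n}\xi_x(a,u)$. *)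

(* Defs.v *)
From HB Require Import structures.
From mathcomp Require Import all_boot all_order all_algebra.
From mathcomp Require Import finmap.
From mathcomp Require Import all_classical all_reals all_analysis.

Set Implicit Arguments.
Unset Strict Implicit.
Unset Printing Implicit Defensive.

Import Order.TTheory GRing.Theory Num.Theory.
Import numFieldNormedType.Exports.

Local Open Scope classical_set_scope.
Local Open Scope ring_scope.

(* Points of R^n are row vectors, so the Jacobian of f at x applied to u is
   u *m 'J f x (see deriveEjacobian). The norm of the normed module 'rV[R]_n is
   the sup norm; it is used for topology and differentiability only, and the
   Euclidean norm is enorm below. *)

Section extrema.
Variable R : realType.
Implicit Type A : set R.

(* Meaningful only when the extremum is attained; 0 otherwise. *)
Definition setmin A : R := xget 0 (A `&` lbound A).
Definition setmax A : R := xget 0 (A `&` ubound A).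

End extrema.

Section calculus.
Variables (R : realType) (n m : nat).

Definition enorm (x : 'rV[R]_n) : R := Num.sqrt (\sum_(i < n) x 0 i ^+ 2).

Definition gradient (g : 'rV[R]_n -> R) (x : 'rV[R]_n) : 'rV[R]_n :=
  \row_(j < n) 'D_(delta_mx 0 j) (g : 'rV[R]_n -> R^o) x.

Definition hessian (g : 'rV[R]_n -> R) (x : 'rV[R]_n) : 'M[R]_n :=
  'J (gradient g) x.

Definition component (f : 'rV[R]_n -> 'rV[R]_m) (k : 'I_m) : 'rV[R]_n -> R :=
  fun x => f x 0 k.

Definition twice_continuously_differentiable (f : 'rV[R]_n -> 'rV[R]_m) : Prop :=
  [/\ forall x, differentiable f x,
      forall k x, differentiable (gradient (component f k)) x &
      forall k, continuous (hessian (component f k))].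

Definition hessian_form (f : 'rV[R]_n -> 'rV[R]_m) (x u : 'rV[R]_n) : 'rV[R]_m :=
  \row_(k < m) (u *m hessian (component f k) x *m u^T) 0 0.

End calculus.

Section cone_order.
Variables (R : realType) (m : nat) (K : set 'rV[R]_m).
Implicit Types (y z e : 'rV[R]_m) (A B : set 'rV[R]_m).

Record proper_cone : Prop := ProperCone {
  proper_cone_closed : closed K ;
  proper_cone_convex : convex_set (K : set (convex_lmodType 'rV[R]_m)) ;
  proper_cone_scale : forall (l : R) y, 0 <= l -> K y -> K (l *: y) ;
  proper_cone_pointed : K `&` [set - y | y in K] = [set 0] ;
  proper_cone_solid : interior K !=set0 }.

Definition preceq y z : Prop := K (z - y).

Definition lower_preceq A B : Prop := B `<=` [set a + k | a in A & k in K].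

Definition lower_prec A B : Prop :=
  B `<=` [set a + k | a in A & k in interior K].

Definition Min A : set 'rV[R]_m :=
  [set z | A z /\ [set z - k | k in K] `&` A = [set z]].

Definition Gerstewitz e z : R :=
  setmin [set t : R | [set z + k | k in K] (t *: e)].

Definition strongly_convex_wrt n e (rho : R) (f : 'rV[R]_n -> 'rV[R]_m) : Prop :=
  forall (x1 x2 : 'rV[R]_n) (l : R), 0 <= l <= 1 ->
    preceq (f (l *: x1 + (1 - l) *: x2))
      (l *: f x1 + (1 - l) *: f x2
       - (2^-1 * rho * l * (1 - l) * enorm (x1 - x2) ^+ 2) *: e).

End cone_order.

Section set_optimization.
Variables (R : realType) (n m p : nat) (K : set 'rV[R]_m) (e : 'rV[R]_m).
Variable f : 'I_p -> 'rV[R]_n -> 'rV[R]_m.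
Implicit Types x u : 'rV[R]_n.

Definition Fset x : set 'rV[R]_m := range (fun i => f i x).

Definition Iset x : set 'I_p := [set i | Min K (Fset x) (f i x)].

Definition Iset_at (r : 'rV[R]_m) x : set 'I_p := [set i | Iset x i /\ f i x = r].

Definition wcard x : nat := #|` fset_set (Min K (Fset x)) |.

Definition Min_enumeration (r : forall x, 'I_(wcard x) -> 'rV[R]_m) : Prop :=
  forall x, set_bij [set: 'I_(wcard x)] (Min K (Fset x)) (r x).

Variable r : forall x, 'I_(wcard x) -> 'rV[R]_m.

Definition partition_set x : set {ffun 'I_(wcard x) -> 'I_p} :=
  [set a | forall j, Iset_at (r j) x (a j)].
Arguments partition_set : clear implicits.

Definition stationary x : Prop :=
  forall a, partition_set x a -> forall u, exists j : 'I_(wcard x),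
    ~ [set - k | k in interior K] (u *m 'J (f (a j)) x).

Definition xi x (a : {ffun 'I_(wcard x) -> 'I_p}) u : R :=
  setmax (range (fun j : 'I_(wcard x) =>
    Gerstewitz K e (u *m 'J (f (a j)) x
                    + 2^-1 *: hessian_form (f (a j)) x u))).
Arguments xi : clear implicits.

Definition Phi x : R :=
  setmin [set xi x au.1 au.2 | au in partition_set x `*` [set: 'rV[R]_n]].

End set_optimization.

Arguments partition_set {R n m p K f} r x _.
Arguments xi {R n m p K} e {f} x a u.

(* Main.v *)
(* Adding a K-strongly convex function's quadratic lower bounds at x and y makes
   its gradient strongly K-monotone, so the Hessian form at u dominates
   rho |u|^2 e. Hence the quadratic models are coercive under the Gerstewitz
   function, the minimum Phi is attained, and it is negative at a nonstationary
   point because a short step along a descent direction has negative value.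
   Negativity puts minus the model value at ubar in int K; adding half the Hessian
   form, which lies in K, shows that every derivative along ubar is in - int K.
   The first-order expansion then gives the sufficient decrease, and the order
   between F(xbar) and the decreased values follows because every element of a
   finite set dominates a minimal one. *)

Require Import Defs.
From HB Require Import structures.
From mathcomp Require Import all_boot all_order all_algebra.
From mathcomp Require Import finmap.
From mathcomp Require Import all_classical all_reals all_analysis.
From mathcomp Require Import ring lra.

Import Order.TTheory GRing.Theory Num.Theory.
Import numFieldNormedType.Exports.

Set Implicit Arguments.
Unset Strict Implicit.
Unset Printing Implicit Defensive.

Local Open Scope classical_set_scope.
Local Open Scope ring_scope.

(** * Attained extrema of sets of reals *)

Section real_extrema.
Context {R : realType}.
Implicit Types (A : set R) (a b : R).

(** [setmin] is a choice with default 0; exhibiting one attained lower bound excludes the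
    default. *)
Lemma setminP A a : A a -> lbound A a -> A (setmin A) /\ lbound A (setmin A).
Proof. by move=> Aa lba; by apply: (@xgetPex _ 0 (A `&` lbound A)); exists a. Qed.

Lemma setmaxP A b : A b -> ubound A b -> A (setmax A) /\ ubound A (setmax A).
Proof. by move=> Ab ubb; by apply: (@xgetPex _ 0 (A `&` ubound A)); exists b. Qed.

(** Seeding the iterated maximum with [g i0] keeps it inside the range, so no foreign default
    enters. *)
Lemma setmax_range (I : finType) (g : I -> R) (i0 : I) :
  setmax (range g) = \big[Num.max/g i0]_i g i.
Proof.
have ub : ubound (range g) (\big[Num.max/g i0]_i g i).
  by move=> _ [i _ <-] /=; apply: le_bigmax.
have im : range g (\big[Num.max/g i0]_i g i).
  apply: (big_ind (range g)) => [|a b ra rb|i _]; first by exists i0.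
  - by case: (leP a b).
  - by exists i.
have [im' ub'] := setmaxP im ub.
by apply/eqP; rewrite eq_le ub//= ub'.
Qed.

End real_extrema.

(** * Algebra and topology of a proper cone *)

Section proper_cone_theory.
Context {R : realType} {m : nat} {K : set 'rV[R]_m}.
Hypothesis K_cone : proper_cone K.
Implicit Types (y z e k v : 'rV[R]_m) (l t : R).

Lemma cone0 : K 0.
Proof.
have [k /interior_subset Kk] := proper_cone_solid K_cone.
by rewrite -(scale0r k); exact: proper_cone_scale.
Qed.

Lemma coneZ l y : 0 <= l -> K y -> K (l *: y).
Proof. exact: proper_cone_scale. Qed.

(** The sum is twice the midpoint, which convexity places in [K]. *)
Lemma coneD y z : K y -> K z -> K (y + z).
Proof.
move=> Ky Kz.
have h0 : (0 : R) <= 2^-1 by lra.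
have h1 : (2^-1 : R) <= 1 by lra.
have := proper_cone_convex K_cone (x := y) (y := z) (Itv01 h0 h1).
rewrite !inE => /(_ Ky Kz) /(coneZ (ler0n R 2)); congr K.
rewrite /conv/= scalerDr !scalerA /unstable.onem.
have -> : 2 / 2 = 1 :> R by lra.
have -> : 2 * (1 - 2^-1) = 1 :> R by lra.
by rewrite !scale1r.
Qed.

Lemma cone_anti y : K y -> K (- y) -> y = 0.
Proof.
move=> Ky KNy; have : (K `&` [set - y | y in K]) y.
  by split=> //; exists (- y) => //; rewrite opprK.
by rewrite (proper_cone_pointed K_cone).
Qed.

(** Translating by [z] carries a neighbourhood of [y] inside [K] to one of [y + z] inside [K]. *)
Lemma interior_coneD y z : interior K y -> K z -> interior K (y + z).
Proof.
move=> Ky Kz.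
suff : \forall w \near y + z, K w by [].
rewrite (near_shift y) /=.
apply: filterS Ky => w Kw /=.
by rewrite addrAC subrr add0r; exact: coneD.
Qed.

Lemma interior_coneZ l y : 0 < l -> interior K y -> interior K (l *: y).
Proof.
move=> l0 Ky.
have : \forall w \near l *: y, K (l^-1 *: w).
  apply: (@scaler_continuous _ _ l^-1 (l *: y)).
  by rewrite scalerA mulVf ?gt_eqF// scale1r.
apply: filterS => w /(coneZ (ltW l0)).
by rewrite scalerA mulfV ?gt_eqF// scale1r.
Qed.

(** * Order units and the Gerstewitz function *)

Section interior_direction.
Variable e : 'rV[R]_m.
Hypothesis e_int : interior K e.

Let Ke : K e. Proof. exact: interior_subset. Qed.

(** If the ball of radius [d] about [e] lies in [K], then [e] minus [v] rescaled to length [d / 2]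
    is in [K]; scaling back gives the constant [2 / d]. *)
Lemma cone_order_unit :
  exists2 C : R, 0 < C & forall v, K ((C * `|v|) *: e - v).
Proof.
have [d /= d0 dK] := (nbhs_ballP _ _).1 e_int.
exists (2 / d) => [|v]; first by rewrite divr_gt0.
have [->|v0] := eqVneq v 0; first by rewrite normr0 mulr0 scale0r subr0; exact: cone0.
have nv : 0 < `|v| by rewrite normr_gt0.
have : K (e - (d / 2 / `|v|) *: v).
  apply: dK; rewrite -ball_normE/= opprD opprK addNKr normrZ.
  rewrite ger0_norm ?divr_ge0//; last lra.
  by rewrite divfK ?gt_eqF//; lra.
move=> /(coneZ (_ : 0 <= 2 / d * `|v|)).
rewrite scalerBr scalerA (_ : _ * (_ / _ / _) = 1) ?scale1r; last first.
  by field; rewrite !gt_eqF.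
by apply; rewrite mulr_ge0// divr_ge0// ltW.
Qed.

Hypothesis m_gt0 : (0 < m)%N.

(** Otherwise pointedness forces [e = 0], and the order unit bound then puts every vector and its
    opposite in [K]. The all-ones vector, nonzero because [m > 0], contradicts pointedness. *)
Lemma interior_coneN : ~ K (- e).
Proof.
move=> KNe; have e0 : e = 0 by exact: cone_anti.
have [C _ KC] := cone_order_unit.
have : const_mx 1 = 0 :> 'rV[R]_m.
  apply: cone_anti.
    by have := KC (- const_mx 1); rewrite e0 scaler0 sub0r opprK.
  by have := KC (const_mx 1); rewrite e0 scaler0 sub0r.
move=> /rowP/(_ (Ordinal m_gt0)); rewrite !mxE => /eqP.
by rewrite oner_eq0.
Qed.

Lemma cone_scale_ge0 t : K (t *: e) -> 0 <= t.
Proof.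
rewrite leNgt => Kt; apply/negP => t0; apply: interior_coneN.
have : K ((- t)^-1 *: (t *: e)) by apply: coneZ => //; rewrite invr_ge0; lra.
by rewrite scalerA invrN mulNr mulVf ?lt_eqF// scaleN1r.
Qed.

Lemma cone_scale_le s t z : s <= t -> K (s *: e - z) -> K (t *: e - z).
Proof.
move=> st Ks; rewrite (_ : _ - z = (t - s) *: e + (s *: e - z)).
  by apply: coneD => //; apply: coneZ => //; rewrite subr_ge0.
by rewrite addrA -scalerDl subrK.
Qed.

Lemma Gerstewitz_set z :
  [set t : R | [set z + k | k in K] (t *: e)] = [set t | K (t *: e - z)].
Proof.
apply/seteqP; split=> t /=; first by move=> [k Kk <-]; rewrite addrC addKr.
by exists (t *: e - z) => //; rewrite addrC subrK.
Qed.

(** The admissible [t] form an upward closed set, bounded below by the order unit estimate and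
    closed because [K] is. Its infimum is therefore attained, so [setmin] is a true minimum. *)
Lemma Gerstewitz_leP z t : Gerstewitz K e z <= t <-> K (t *: e - z).
Proof.
rewrite /Gerstewitz Gerstewitz_set; set A := [set t | _].
have [C C0 KC] := cone_order_unit.
have A0 : A !=set0 by exists (C * `|z|); exact: KC.
have lbA : lbound A (- (C * `|z|)).
  move=> s /= Ks; have := coneD Ks (KC (- z)).
  rewrite normrN opprK addrA (addrAC _ (- z)) subrK -scalerDl.
  by move=> /cone_scale_ge0; lra.
have infA : has_inf A by split=> //; exists (- (C * `|z|)).
have Ainf : A (inf A).
  (* Each [inf A + s] with [s > 0] is admissible by upward closure; let [s] tend to 0 from the
     right. *)
  suff : (fun s => K s) ((inf A + 0) *: e - z) by rewrite addr0.
  apply: (@closed_cvg _ _ (0 : R)^'+ _ (fun s => (inf A + s) *: e - z) K).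
  - exact: proper_cone_closed.
  - near=> s; have s0 : 0 < s by [].
    have [a Aa /ltW] := inf_adherent s0 infA.
    by move/cone_scale_le; apply.
  - apply: cvgB; last exact: cvg_cst.
    apply: cvgZl; apply: cvgD; first exact: cvg_cst.
    exact/cvg_at_right_filter/cvg_id.
have [Am lbm] := setminP Ainf (fun a Aa => ge_inf (ex_intro _ _ lbA) Aa).
by split=> [le_t|/lbm//]; exact: cone_scale_le le_t Am.
Unshelve. all: by end_near. Qed.

(** The function is Lipschitz: [(C * |y - z|) *: e] dominates [y - z] in the cone order. *)
Lemma Gerstewitz_continuous : continuous (Gerstewitz K e).
Proof.
have [C C0 KC] := cone_order_unit.
have lip y z : Gerstewitz K e y <= Gerstewitz K e z + C * `|y - z|.
  apply/Gerstewitz_leP; have /Gerstewitz_leP := lexx (Gerstewitz K e z).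
  move=> /coneD /(_ (KC (y - z))); congr K.
  by rewrite scalerDl opprB addrACA addKr.
move=> y; apply/(@cvgrPdist_lt _ _ _ (nbhs y)) => eps eps0; near=> z.
have : `|y - z| < eps / C.
  by near: z; apply: cvgr_dist_lt; [exact: cvg_id|exact: divr_gt0].
rewrite ltr_pdivlMr// mulrC => dyz.
have := lip y z; have := lip z y; rewrite distrC => h1 h2.
by rewrite ltr_norml; lra.
Unshelve. all: by end_near. Qed.

End interior_direction.
End proper_cone_theory.

(** * Coordinatewise limits of row vectors *)

Section row_vector_limits.
Context {R : realType}.

Lemma cvg_bigmax (T I : Type) (F : set_system T) {FF : Filter F} (s : seq I)
    (g : I -> T -> R) (l : I -> R) (z : T -> R) (c : R) :
  z @ F --> c -> (forall i, g i @ F --> l i) ->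
  \big[Num.max/z t]_(i <- s) g i t @[t --> F] --> \big[Num.max/c]_(i <- s) l i.
Proof.
move=> zc gl; elim: s => [|i s IHs].
  by rewrite big_nil; under eq_cvg do rewrite big_nil.
rewrite big_cons; under eq_cvg do rewrite big_cons.
apply: (@continuous2_cvg _ _ _ _ _ _ _ _ Num.max) => //.
exact: (@max_continuous _ R (_, _)).
Qed.

Lemma cvg_rowP n (T : Type) (F : set_system T) {FF : Filter F}
    (g : T -> 'rV[R]_n) (l : 'rV[R]_n) :
  (forall k, g t 0 k @[t --> F] --> l 0 k) -> g @ F --> l.
Proof.
move=> gl; apply/cvgrPdist_le => eps eps0; near=> t.
rewrite /Num.Def.normr/= mx_normrE (bigmax_le _ (ltW eps0))//= => -[i k] _.
rewrite !mxE ord1/=.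
move: k; near: t; apply: filter_forall => k.
exact: ((cvgrPdist_le _ _).1 (gl k)).
Unshelve. all: by end_near. Qed.

Lemma cvg_row_coord n (T : Type) (F : set_system T) {FF : Filter F}
    (g : T -> 'rV[R]_n) (l : 'rV[R]_n) (k : 'I_n) :
  g @ F --> l -> g t 0 k @[t --> F] --> l 0 k.
Proof.
by move=> gl; exact: (cvg_comp g (fun v : 'rV[R]_n => v 0 k) gl (@coord_continuous R 1 n 0 k l)).
Qed.

Lemma cvg_row_mulmxl n m (T : Type) (F : set_system T) {FF : Filter F}
    (g : T -> 'rV[R]_n) (l : 'rV[R]_n) (M : 'M[R]_(n, m)) :
  g @ F --> l -> g t *m M @[t --> F] --> l *m M.
Proof.
move=> gl; apply: cvg_rowP => k.
rewrite mxE; under eq_cvg do rewrite mxE.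
apply: cvg_big => [|j _]; first exact: add_continuous.
by apply: cvgMl; exact: cvg_row_coord.
Qed.

End row_vector_limits.

(** * Comparison of the Euclidean and sup norms *)

Section euclidean_norm.
Context {R : realType} {n : nat}.
Implicit Types u : 'rV[R]_n.

Lemma enorm_sqr u : enorm u ^+ 2 = \sum_(i < n) u 0 i ^+ 2.
Proof. by rewrite sqr_sqrtr//; apply: sumr_ge0 => i _; exact: sqr_ge0. Qed.

Lemma enormZ_sqr t u : enorm (t *: u) ^+ 2 = t ^+ 2 * enorm u ^+ 2.
Proof.
rewrite !enorm_sqr mulr_sumr; apply: eq_bigr => i _.
by rewrite mxE exprMn.
Qed.

Lemma enormN_sqr u : enorm (- u) ^+ 2 = enorm u ^+ 2.
Proof. by rewrite -scaleN1r enormZ_sqr sqrrN expr1n mul1r. Qed.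

(** Strong convexity controls the Euclidean norm, while boundedness is measured in the sup norm,
    which is attained at one coordinate. *)
Lemma norm_le_enorm_sqr u : `|u| ^+ 2 <= enorm u ^+ 2.
Proof.
have [->|u0] := eqVneq `|u| 0; first by rewrite expr0n sqr_ge0.
have [[i j] /= uij] := mx_norm_neq0 u0.
have -> : `|u| = `|u 0 j| by rewrite -(ord1 i).
rewrite enorm_sqr real_normK ?num_real// (bigD1 j)//= lerDl.
by apply: sumr_ge0 => k _; exact: sqr_ge0.
Qed.

End euclidean_norm.

(** * Directional limits of first and second derivatives *)

Section jacobian_limits.
Context {R : realType} {n m : nat} {f : 'rV[R]_n -> 'rV[R]_m}.
Implicit Types x u : 'rV[R]_n.

(** The limit is one-sided because scaling by [t] or [t^-1] preserves [K] only for positive [t]. *)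
Lemma directional_cvg q (g : 'rV[R]_n -> 'rV[R]_q) x u : differentiable g x ->
  t^-1 *: (g (x + t *: u) - g x) @[t --> 0^'+] --> u *m 'J g x.
Proof.
move=> dg; rewrite -deriveEjacobian//.
apply: cvg_dnbhs_at_right.
under eq_cvg do rewrite (addrC x).
exact: (diff_derivable dg).
Qed.

Lemma jacobian_gradient x (k : 'I_m) : differentiable f x ->
  gradient (component f k) x = (col k ('J f x))^T.
Proof.
move=> df; apply/rowP => j; rewrite !mxE.
have := deriveEjacobian (delta_mx 0 j) df.
rewrite derive_mx; last exact: diff_derivable.
by rewrite -rowE => /rowP/(_ k); rewrite !mxE.
Qed.

Hypothesis f_C2 : twice_continuously_differentiable f.

(** Column [k] of the Jacobian is the gradient of component [k], so each coordinate is a difference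
    quotient of that gradient along [u], paired with [u]. *)
Lemma hessian_form_cvg x u :
  t^-1 *: (u *m ('J f (x + t *: u) - 'J f x)) @[t --> 0^'+] --> hessian_form f x u.
Proof.
have [df dg _] := f_C2.
apply: cvg_rowP => k; rewrite mxE.
have := directional_cvg (u := u) (dg k x).
move=> /(cvg_row_mulmxl (M := u^T))/(cvg_row_coord (k := 0)).
apply: cvg_trans; apply: near_eq_cvg; near=> t.
rewrite !jacobian_gradient//.
rewrite -scalemxAl mxE [RHS]mxE; congr (_ * _).
by rewrite !mxE; apply: eq_bigr => j _; rewrite !mxE mulrC.
Unshelve. all: by end_near. Qed.

End jacobian_limits.

(** * First- and second-order consequences of strong convexity *)

Section strong_convexity.
Context {R : realType} {n m : nat} {K : set 'rV[R]_m} {e : 'rV[R]_m}.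
Context {rho : R} {f : 'rV[R]_n -> 'rV[R]_m}.
Hypothesis K_cone : proper_cone K.
Hypothesis f_C2 : twice_continuously_differentiable f.
Hypothesis f_convex : strongly_convex_wrt K e rho f.
Implicit Types x y u : 'rV[R]_n.

Let df x : differentiable f x. Proof. by case: f_C2. Qed.

(** Strong convexity at [x + t *: (y - x)], divided by [t], passes to the limit at 0 since [K] is
    closed. *)
Lemma strongly_convex_gradient x y :
  K (f y - f x - (y - x) *m 'J f x - (2^-1 * rho * enorm (y - x) ^+ 2) *: e).
Proof.
set d := y - x; set c := 2^-1 * rho * enorm d ^+ 2.
(* The factor [1 - 0] exhibits the bound as the limit of the terms with [1 - t]. *)
suff : (fun s => K s) (f y - f x - d *m 'J f x - (c * (1 - 0)) *: e).
  by rewrite subr0 mulr1.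
apply: (@closed_cvg _ _ (0 : R)^'+ _
    (fun t => f y - f x - t^-1 *: (f (x + t *: d) - f x) - (c * (1 - t)) *: e)).
- exact: proper_cone_closed.
- near=> t.
  have t0 : 0 < t by [].
  have t1 : t <= 1 by near: t; exact: nbhs_right_le.
  have t01 : 0 <= t <= 1 by rewrite ltW.
  have := f_convex y x t01; rewrite /preceq.
  have -> : t *: y + (1 - t) *: x = x + t *: d.
    by rewrite /d scalerBl scale1r scalerBr addrCA.
  have it0 : 0 <= t^-1 by rewrite invr_ge0 ltW.
  move=> /(coneZ K_cone it0); congr K.
  rewrite -/d /c; apply/rowP => k; rewrite !mxE; field.
  by rewrite gt_eqF.
- apply: cvgB.
    apply: cvgB; first exact: cvg_cst.
    exact: directional_cvg.
  apply: cvgZl; apply: cvgMr; apply: cvgB; first exact: cvg_cst.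
  exact/cvg_at_right_filter/cvg_id.
Unshelve. all: by end_near. Qed.

Lemma strongly_convex_monotone x y :
  K ((y - x) *m ('J f y - 'J f x) - (rho * enorm (y - x) ^+ 2) *: e).
Proof.
have := coneD K_cone (strongly_convex_gradient x y) (strongly_convex_gradient y x).
rewrite -(opprB y x) enormN_sqr; congr K.
generalize ('J f x) ('J f y) (f x) (f y) => Jx Jy fx fy.
rewrite mulNmx opprK mulmxBr.
set a := (y - x) *m Jy; set b := (y - x) *m Jx.
by apply/rowP => k; rewrite !mxE; field.
Qed.

(** Monotonicity between [x] and [x + t *: u] is quadratic in [t]; scaling it by [t^-2] leaves the
    difference quotient of the Jacobian. *)
Lemma strongly_convex_hessian x u :
  K (hessian_form f x u - (rho * enorm u ^+ 2) *: e).
Proof.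
apply: (@closed_cvg _ _ (0 : R)^'+ _
    (fun t => t^-1 *: (u *m ('J f (x + t *: u) - 'J f x)) - (rho * enorm u ^+ 2) *: e)).
- exact: proper_cone_closed.
- near=> t; have t0 : 0 < t by [].
  have := strongly_convex_monotone x (x + t *: u).
  move=> /(coneZ K_cone (sqr_ge0 t^-1)); congr K.
  rewrite (addrC x) addrK enormZ_sqr -scalemxAl scalerBr !scalerA.
  by congr (_ *: _ - _ *: _); field; rewrite gt_eqF.
- by apply: cvgB; [exact: hessian_form_cvg|exact: cvg_cst].
Unshelve. all: by end_near. Qed.

End strong_convexity.

(** * Sign of the Gerstewitz function and attainment of minima *)

Section gerstewitz_sign.
Context {R : realType} {m : nat} {K : set 'rV[R]_m} {e : 'rV[R]_m}.
Hypotheses (K_cone : proper_cone K) (e_int : interior K e) (m_gt0 : (0 < m)%N).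

(** A negative value [s] writes [- z] as the interior vector [(- s) *: e] plus a cone element.
    Conversely, an interior [- z] leaves room to subtract a small positive multiple of [e]. *)
Lemma Gerstewitz_lt0P z : Gerstewitz K e z < 0 <-> interior K (- z).
Proof.
split=> [z0|zint].
  have /(Gerstewitz_leP K_cone e_int m_gt0) := lexx (Gerstewitz K e z).
  set s := Gerstewitz K e z => Ks.
  rewrite (_ : - z = (- s) *: e + (s *: e - z)).
    by apply: interior_coneD => //; apply: interior_coneZ => //; rewrite oppr_gt0.
  by rewrite addrA -scalerDl addNr scale0r add0r.
have : \forall s \near (0 : R)^'+, K (- z - s *: e).
  have : - z - s *: e @[s --> (0 : R)^'+] --> - z - 0 *: e.
    apply: cvgB; first exact: cvg_cst.
    by apply: cvgZl; exact/cvg_at_right_filter/cvg_id.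
  by apply; rewrite scale0r subr0.
move=> /(filterI (nbhs_right_gt (0 : R)))/filter_ex[s [s0 Ks]].
apply: (@le_lt_trans _ _ (- s)); last by rewrite oppr_lt0.
by apply/(Gerstewitz_leP K_cone e_int m_gt0); rewrite scaleNr addrC.
Qed.

End gerstewitz_sign.

(** The sublevel set at 0 is compact and contains [u0]; outside it [G] is positive, hence above the
    minimum found there. *)
Lemma coercive_min {R : realType} n (G : 'rV[R]_n -> R) (b : R) (u0 : 'rV[R]_n) :
  continuous G -> (forall u, G u <= 0 -> `|u| <= b) -> G u0 <= 0 ->
  exists c, forall u, G c <= G u.
Proof.
move=> G_cont G_coer Gu0; pose A := [set u | G u <= 0].
have A_closed : closed A.
  apply: (@closed_comp _ _ G [set r | r <= 0]); last exact: closed_le.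
  by move=> u _; exact: G_cont.
have A_bounded : bounded_set A.
  exists b; split; first exact: num_real.
  by move=> M bM u /= /G_coer ub; apply: le_trans ub (ltW bM).
have A0 : A !=set0 by exists u0.
have [c] := compact_EVT_min A0 (bounded_closed_compact A_bounded A_closed)
  (continuous_subspaceT G_cont).
rewrite inE => /= Gc0 cmin; exists c => u.
case: (leP (G u) 0) => [Gu|Gu]; first by apply: cmin; rewrite inE.
by rewrite (le_trans Gc0)// ltW.
Qed.

(** * Quadratic models: continuity, descent and coercivity *)

Section newton_model.
Context {R : realType} {n m : nat} {K : set 'rV[R]_m} {e : 'rV[R]_m}.
Hypotheses (K_cone : proper_cone K) (e_int : interior K e) (m_gt0 : (0 < m)%N).
Implicit Types (f : 'rV[R]_n -> 'rV[R]_m) (x u : 'rV[R]_n).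

(** The second-order Taylor increment, which is the argument of the Gerstewitz function in [xi]. *)
Definition quadratic_model f x u : 'rV[R]_m :=
  u *m 'J f x + 2^-1 *: hessian_form f x u.

Lemma cvg_quadratic_model (T : Type) (F : set_system T) {FF : Filter F}
    (g : T -> 'rV[R]_n) u f x :
  g @ F --> u -> quadratic_model f x (g t) @[t --> F] --> quadratic_model f x u.
Proof.
move=> gu; apply: cvgD; first exact: cvg_row_mulmxl.
apply: cvgZr; apply: cvg_rowP => k.
have formE (v : 'rV[R]_n) :
    (v *m hessian (component f k) x *m v^T) 0 0 =
    \sum_j (v *m hessian (component f k) x) 0 j * v 0 j.
  by rewrite mxE; apply: eq_bigr => j _; rewrite [v^T _ _]mxE.
rewrite mxE formE; under eq_cvg do rewrite mxE formE.
apply: cvg_big => [|j _]; first exact: add_continuous.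
by apply: cvgM; apply: cvg_row_coord => //; exact: cvg_row_mulmxl.
Qed.

Lemma quadratic_model_continuous f x : continuous (quadratic_model f x).
Proof. by move=> u; exact: (cvg_quadratic_model (FF := nbhs_filter u)). Qed.

(** The model at [t *: u] is [t] times the derivative along [u] plus a term of order [t], so for
    small [t] the open condition on the derivative persists. *)
Lemma quadratic_model_descent f x u : interior K (- (u *m 'J f x)) ->
  \forall t \near 0^'+, Gerstewitz K e (quadratic_model f x (t *: u)) < 0.
Proof.
move=> u_desc.
have : \forall t \near (0 : R)^'+,
    interior K (- (u *m 'J f x) - t *: (2^-1 *: hessian_form f x u)).
  have lim_desc : - (u *m 'J f x) - t *: (2^-1 *: hessian_form f x u)
      @[t --> (0 : R)^'+] --> - (u *m 'J f x).
    rewrite -[X in _ --> X]subr0 -(scale0r (2^-1 *: hessian_form f x u)).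
    apply: cvgB; first exact: cvg_cst.
    by apply: cvgZl; exact/cvg_at_right_filter/cvg_id.
  exact: lim_desc (nbhs_interior u_desc).
apply: filterS2 (nbhs_right_gt (0 : R)) => t t0 /(interior_coneZ K_cone t0) tint.
apply/(Gerstewitz_lt0P K_cone e_int m_gt0); move: tint; congr (interior K _).
rewrite /quadratic_model.
have -> : hessian_form f x (t *: u) = t ^+ 2 *: hessian_form f x u.
  apply/rowP => k; rewrite mxE [RHS]mxE [X in _ = _ * X]mxE.
  by rewrite [(t *: u)^T]linearZ/= -!scalemxAl -scalemxAr scalerA [LHS]mxE.
rewrite -scalemxAl scalerBr scalerN opprD !scalerA.
by congr (_ - _ *: _); rewrite expr2; ring.
Qed.

(** With [w] the derivative along [u] and [L] a Lipschitz constant of the Jacobian map, a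
    nonpositive value gives [rho / 2 * |u|^2 <= C * |w| <= C * L * |u|], whence the bound
    [2 * C * L / rho]. *)
Lemma strongly_convex_coercive f x (rho : R) : 0 < rho ->
  twice_continuously_differentiable f -> strongly_convex_wrt K e rho f ->
  exists b, forall u, Gerstewitz K e (quadratic_model f x u) <= 0 -> `|u| <= b.
Proof.
move=> rho0 f_C2 f_convex.
have [C C0 KC] := cone_order_unit K_cone e_int.
have mul_cont : continuous (mulmxr ('J f x) : 'rV[R]_n -> 'rV[R]_m).
  by move=> u; exact: (cvg_row_mulmxl (FF := nbhs_filter u)).
have [L L0 JL] := linear_lipschitz mul_cont.
exists (2 * C * L / rho) => u /(Gerstewitz_leP K_cone e_int m_gt0) Ku.
have Kh := coneZ K_cone (_ : 0 <= 2^-1) (strongly_convex_hessian K_cone f_C2 f_convex x u).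
have := coneD K_cone Ku (Kh _); rewrite invr_ge0 ler0n => /(_ isT).
move=> /(coneD K_cone (KC (- (u *m 'J f x)))).
set q := enorm u ^+ 2; set w := u *m 'J f x.
have -> : (C * `|- w|) *: e - - w +
   (0 *: e - quadratic_model f x u + 2^-1 *: (hessian_form f x u - (rho * q) *: e))
   = (C * `|w| - 2^-1 * rho * q) *: e.
  rewrite /quadratic_model -/w normrN.
  move: (hessian_form f x u) => h.
  by apply/rowP => k; rewrite !mxE; ring.
move=> /(cone_scale_ge0 K_cone e_int m_gt0) Cq.
have wL : `|w| <= L * `|u| := JL u.
have uq : `|u| ^+ 2 <= q := norm_le_enorm_sqr u.
have [->|u0] := eqVneq `|u| 0.
  by rewrite divr_ge0 ?mulr_ge0// ltW.
have {}u0 : 0 < `|u| by rewrite lt_def u0/=.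
rewrite ler_pdivlMr// -(ler_pM2r u0).
have : C * `|w| <= C * (L * `|u|) by rewrite ler_pM2l.
have : rho * `|u| ^+ 2 <= rho * q by rewrite ler_pM2l.
rewrite expr2; lra.
Qed.

End newton_model.

(** Among the indices below [i], take [k] with the fewest indices below it. Any [l] below [k] has
    its lower set inside that of [k]; minimality makes them equal, so [k] is also below [l] and
    pointedness gives [F k = F l]. *)
Lemma Min_dominates {R : realType} m (K : set 'rV[R]_m) p (F : 'I_p -> 'rV[R]_m)
    (i : 'I_p) : proper_cone K ->
  exists2 k, Min K (range F) (F k) & K (F i - F k).
Proof.
move=> K_cone; pose below k : pred 'I_p := fun l => `[< K (F k - F l) >].
have below_refl k : below k k by apply/asboolP; rewrite subrr; exact: cone0.
have below_trans k l h : below k l -> below l h -> below k h.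
  move=> /asboolP Kkl /asboolP Klh; apply/asboolP.
  by rewrite -(subrK (F l) (F k)) -addrA; exact: coneD.
have [k ik k_min] := arg_minnP (fun k => #|below k|) (below_refl i).
exists k; last exact/asboolP.
split=> [|]; first by exists k.
apply/seteqP; split=> [_ [[c Kc <-] [l _ Fl]]|_ ->]; last first.
  by split; [exists 0; [exact: cone0|rewrite subr0]|exists k].
have kl : below k l by apply/asboolP; rewrite Fl opprB addrC subrK.
have sub_lk : below l \subset below k.
  by apply/fintype.subsetP => h; exact: below_trans kl.
have /fintype.subsetP/(_ k (below_refl k))/asboolP Klk : below k \subset below l.
  rewrite -(subset_leqif_card sub_lk).2 eqn_leq subset_leq_card//=.
  by apply: k_min; exact: below_trans ik kl.
rewrite /= -Fl; apply: subr0_eq; apply: (cone_anti K_cone) => //.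
by rewrite opprB; exact/asboolP.
Qed.

(** * Sufficient decrease along a descent direction *)

Section descent.
Context {R : realType} {n m : nat} {K : set 'rV[R]_m}.
Hypothesis K_cone : proper_cone K.

(** The gap between the slope [beta *: w] and the difference quotient tends to
    [(1 - beta) *: (- w)], which is interior because [beta < 1]. *)
Lemma line_search (f : 'rV[R]_n -> 'rV[R]_m) (x u : 'rV[R]_n) (beta : R) :
  differentiable f x -> beta < 1 -> interior K (- (u *m 'J f x)) ->
  \forall t \near 0^'+, preceq K (f (x + t *: u)) (f x + (beta * t) *: (u *m 'J f x)).
Proof.
move=> df beta1; set w := u *m 'J f x => w_int.
have lim_slope : beta *: w - t^-1 *: (f (x + t *: u) - f x) @[t --> 0^'+] -->
    (1 - beta) *: (- w).
  rewrite (_ : _ *: - w = beta *: w - w); last first.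
    by rewrite scalerN -scaleNr opprB scalerBl scale1r.
  by apply: cvgB; [exact: cvg_cst|exact: directional_cvg].
have beta1' : 0 < 1 - beta by rewrite subr_gt0.
have := lim_slope _ (interior_coneZ K_cone beta1' w_int).
apply: filterS2 (nbhs_right_gt (0 : R)) => t t0 /(coneZ K_cone (ltW t0)).
rewrite /preceq; congr K.
rewrite scalerBr !scalerA mulfV ?gt_eqF// scale1r mulrC opprB addrCA.
by rewrite addrA.
Qed.

End descent.

(** * Attainment of the minimal value [Phi] *)

Section minimal_value.
Context {R : realType} {n m p : nat} {K : set 'rV[R]_m} {e : 'rV[R]_m}.
Context {f : 'I_p -> 'rV[R]_n -> 'rV[R]_m} {rho : 'I_p -> R}.
Context {r : forall x : 'rV[R]_n, 'I_(wcard K f x) -> 'rV[R]_m}.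
Hypotheses (K_cone : proper_cone K) (e_int : interior K e) (m_gt0 : (0 < m)%N).
Hypothesis f_C2 : forall i, twice_continuously_differentiable (f i).
Hypothesis rho_gt0 : forall i, 0 < rho i.
Hypothesis f_convex : forall i, strongly_convex_wrt K e (rho i) (f i).
Variables (x : 'rV[R]_n) (j0 : 'I_(wcard K f x)).
Implicit Types (a : {ffun 'I_(wcard K f x) -> 'I_p}) (u : 'rV[R]_n).

(** The index [j0] witnesses that the maximum defining [xi] runs over a nonempty family. *)
Lemma xiE a u : xi e x a u =
  \big[Num.max/Gerstewitz K e (quadratic_model (f (a j0)) x u)]_j
     Gerstewitz K e (quadratic_model (f (a j)) x u).
Proof. exact: setmax_range. Qed.

Lemma Gerstewitz_le_xi a u j :
  Gerstewitz K e (quadratic_model (f (a j)) x u) <= xi e x a u.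
Proof. by rewrite xiE; exact: le_bigmax. Qed.

Lemma xi_lt0 a u :
  (forall j, Gerstewitz K e (quadratic_model (f (a j)) x u) < 0) -> xi e x a u < 0.
Proof. by move=> a0; rewrite xiE; exact: bigmax_lt. Qed.

Lemma xi_continuous a : continuous (xi e x a).
Proof.
pose psi j v := Gerstewitz K e (quadratic_model (f (a j)) x v).
have psi_cont j : continuous (psi j).
  move=> v; apply: (@continuous_comp _ _ _ (quadratic_model (f (a j)) x)).
    exact: quadratic_model_continuous.
  exact: Gerstewitz_continuous.
rewrite (funext (xiE a)) => u.
exact: (cvg_bigmax (s := index_enum _) (g := psi)
  (psi_cont j0 u) (fun j => psi_cont j u)).
Qed.

(** Coercivity of the single model at [j0] suffices, since [xi] dominates it. *)
Lemma xi_attains a u0 : xi e x a u0 <= 0 ->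
  exists c, forall u, xi e x a c <= xi e x a u.
Proof.
move=> a0.
have [b b_coer] := strongly_convex_coercive K_cone e_int m_gt0 x (rho_gt0 (a j0))
  (f_C2 (a j0)) (f_convex (a j0)).
apply: (coercive_min (b := b) _ _ a0); first exact: xi_continuous.
by move=> u /(le_trans (Gerstewitz_le_xi a u j0))/b_coer.
Qed.

(** Only tuples with a nonpositive value compete; each has a minimiser, and finitely many tuples
    leave a best one. The minimum in [Phi] is thus attained and [setmin] is not at its default. *)
Lemma Phi_le_xi a0 u0 : partition_set r x a0 -> xi e x a0 u0 <= 0 ->
  forall a u, partition_set r x a -> Phi e r x <= xi e x a u.
Proof.
move=> Pa0 a0u0.
pose good a := `[< partition_set r x a /\ exists u, xi e x a u <= 0 >].
have /choice[c c_min] a : exists c, good a -> forall u, xi e x a c <= xi e x a u.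
  have [/asboolP[_ [u /xi_attains[c c_min]]]|] := boolP (good a); first by exists c.
  by exists 0.
have good0 : good a0 by apply/asboolP; split=> //; exists u0.
have [a1 good1 a1_min] := arg_minP (fun a => xi e x a (c a)) good0.
set S := [set xi e x au.1 au.2 | au in partition_set r x `*` [set: 'rV[R]_n]].
have Sa1 : S (xi e x a1 (c a1)).
  by exists (a1, c a1) => //; split=> //; have /asboolP[] := good1.
have lb1 a u : partition_set r x a -> xi e x a1 (c a1) <= xi e x a u.
  move=> Pa; have [au0|au0] := leP (xi e x a u) 0.
    have good_a : good a by apply/asboolP; split=> //; exists u.
    by apply: le_trans (a1_min _ good_a) _; exact: c_min.
  (* Here the value at [u] is positive, so it exceeds the value at [(a0, u0)], which bounds the best
     minimum from above. *)
  apply: le_trans (ltW au0); apply: le_trans a0u0.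
  by apply: le_trans (a1_min _ good0) _; exact: c_min.
have [_ lbS] : S (Phi e r x) /\ lbound S (Phi e r x).
  by apply: (setminP Sa1) => _ [[a u] [/= Pa _] <-]; exact: lb1.
by move=> a u Pa; apply: lbS; exists (a, u).
Qed.

End minimal_value.

Theorem proposition4p3 (R : realType) (n m p : nat)
    (m_gt0 : (0 < m)%N) (p_gt0 : (0 < p)%N)
    (K : set 'rV[R]_m) (K_cone : proper_cone K)
    (e : 'rV[R]_m) (e_int : interior K e)
    (f : 'I_p -> 'rV[R]_n -> 'rV[R]_m)
    (f_C2 : forall i, twice_continuously_differentiable (f i))
    (rho : 'I_p -> R) (rho_gt0 : forall i, 0 < rho i)
    (f_convex : forall i, strongly_convex_wrt K e (rho i) (f i))
    (r : forall x : 'rV[R]_n, 'I_(wcard K f x) -> 'rV[R]_m)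
    (r_enum : Min_enumeration r)
    (beta : R) (beta01 : 0 < beta < 1)
    (xbar : 'rV[R]_n) (abar : {ffun 'I_(wcard K f xbar) -> 'I_p}) (ubar : 'rV[R]_n)
    (abar_in : partition_set r xbar abar)
    (Phi_eq : Phi e r xbar = xi e xbar abar ubar)
    (xbar_nonstationary : ~ stationary r xbar) :
  exists ttilde : R, [/\ 0 < ttilde,
    forall (t : R) (j : 'I_(wcard K f xbar)), 0 < t <= ttilde ->
      preceq K (f (abar j) (xbar + t *: ubar))
        (f (abar j) xbar + (beta * t) *: (ubar *m 'J (f (abar j)) xbar)) &
    forall t : R, 0 < t <= ttilde ->
      let B := range (fun j : 'I_(wcard K f xbar) =>
        f (abar j) xbar + (beta * t) *: (ubar *m 'J (f (abar j)) xbar)) in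
      lower_preceq K (Fset f (xbar + t *: ubar)) B /\ lower_prec K B (Fset f xbar)].
Proof.
have [beta0 beta1] := andP beta01.
have f_diff i x : differentiable (f i) x by case: (f_C2 i).
have dominated (x : 'rV[R]_n) i : exists j, K (f i x - r x j).
  have [k Mk Kik] := Min_dominates (fun i => f i x) i K_cone.
  have [_ _ /(_ _ Mk)[j _ rj]] := r_enum x.
  by exists j; rewrite rj.
(* Since [p > 0], some image value exists, and the minimal value below it shows that the index type
   is inhabited. *)
have [j0 _] := dominated xbar (Ordinal p_gt0).
have [a0 Pa0 [u0 desc0]] : exists2 a0, partition_set r xbar a0 &
    exists u0, forall j, interior K (- (u0 *m 'J (f (a0 j)) xbar)).
  apply: contrapT => no_desc; apply: xbar_nonstationary => a Pa u.
  apply: contrapT => no_j; apply: no_desc; exists a => //; exists u => j.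
  apply: contrapT => not_int; apply: no_j; exists j => -[k k_int kE].
  by apply: not_int; rewrite -kE opprK.
have Phi_lt0 : Phi e r xbar < 0.
  have : \forall t \near (0 : R)^'+, forall j,
      Gerstewitz K e (quadratic_model (f (a0 j)) xbar (t *: u0)) < 0.
    by apply: filter_forall => j; exact: quadratic_model_descent.
  move=> /filter_ex[t /(xi_lt0 j0) xi_lt0].
  exact: le_lt_trans (Phi_le_xi K_cone e_int m_gt0 f_C2 rho_gt0 f_convex j0
    Pa0 (ltW xi_lt0) _ Pa0) xi_lt0.
have ubar_descent j : interior K (- (ubar *m 'J (f (abar j)) xbar)).
  have /(Gerstewitz_lt0P K_cone e_int m_gt0) :
      Gerstewitz K e (quadratic_model (f (abar j)) xbar ubar) < 0.
    by rewrite (le_lt_trans (Gerstewitz_le_xi j0 _ _ j))// -Phi_eq.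
  (* Adding half the Hessian form to the negated model cancels the second-order term and leaves the
     negated derivative. *)
  have := strongly_convex_hessian K_cone (f_C2 (abar j)) (f_convex (abar j)) xbar ubar.
  set h := hessian_form _ _ _; set q := rho _ * _ => Kh model_int.
  have Kh' : K h.
    rewrite -(subrK (q *: e) h); apply: (coneD K_cone) => //.
    apply: (coneZ K_cone); last exact: interior_subset.
    by rewrite mulr_ge0 ?sqr_ge0// ltW.
  have half0 : (0 : R) <= 2^-1 by rewrite invr_ge0.
  have := interior_coneD K_cone model_int (coneZ K_cone half0 Kh').
  by rewrite /quadratic_model -/h opprD subrK.
have : \forall t \near (0 : R)^'+, forall j,
    preceq K (f (abar j) (xbar + t *: ubar))
      (f (abar j) xbar + (beta * t) *: (ubar *m 'J (f (abar j)) xbar)).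
  by apply: filter_forall => j; exact: line_search.
(* The neighbourhood is an open ball of radius [d]; taking [d / 2] allows the closed endpoint. *)
move=> [d /= d0 near_d].
have descent t j : 0 < t <= d / 2 ->
    preceq K (f (abar j) (xbar + t *: ubar))
      (f (abar j) xbar + (beta * t) *: (ubar *m 'J (f (abar j)) xbar)).
  move=> /andP[t0 td]; apply: near_d => //=.
  by rewrite sub0r normrN gtr0_norm//; lra.
exists (d / 2); split; [by rewrite divr_gt0|by move=> t j; exact: descent|].
move=> t td; split.
  move=> _ [j _ <-]; have := descent t j td; rewrite /preceq.
  set y := f _ (_ + _); set b := f _ _ + _ => Kby.
  exists y; first by exists (abar j).
  by exists (b - y) => //; rewrite addrC subrK.
(* The value [f i xbar] dominates [r xbar j], which is [f (abar j) xbar]; the negated step is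
   interior, so the total excess over the decreased value is interior. *)
move=> _ [i _ <-]; have [j Kij] := dominated xbar i.
have [_ fj] := abar_in j.
exists (f (abar j) xbar + (beta * t) *: (ubar *m 'J (f (abar j)) xbar)).
  by exists j.
have bt0 : 0 < beta * t by case/andP: td => t0 _; rewrite mulr_gt0.
have := interior_coneD K_cone (interior_coneZ K_cone bt0 (ubar_descent j)) Kij.
move=> step_int; eexists; first exact: step_int.
by rewrite scalerN fj addrA addrK addrC subrK.
Qed.
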